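(* Let $\mathcal{A}$ be an arbitrary C*-algebra, let $E, F, G$ be Hilbert $\mathcal{A}$-modules, and let $S \in \mathcal{L}(E,F)$ and $T \in \mathcal{L}(F,G)$ be such that $S$, $T$ and $TS \in \mathcal{L}(E,G)$ all have closed ranges. Then the following statements are equivalent: (i) $(TS)^{\dagger} = S^{\dagger} T^{\dagger}$; (ii) $TS(TS)^{\dagger} = TSS^{\dagger}T^{\dagger}$ and $(TS)^{\dagger}TS = S^{\dagger}T^{\dagger}TS$; (iii) $SS^{\dagger}T^{*}TS = T^{*}TS$ and $TSS^{*}T^{\dagger}T = TSS^{*}$; (iv) $\mathrm{Ran}(T^{*}TS) \subseteq \mathrm{Ran}(S)$ and $\mathrm{Ran}(SS^{*}T^{*}) \subseteq \mathrm{Ran}(T^{*})$.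
   Context: A Hilbert $\mathcal{A}$-module is a right $\mathcal{A}$-module (with compatible complex vector space structure) with an $\mathcal{A}$-valued inner product that is $\mathbb{C}$-linear and $\mathcal{A}$-linear in the second variable, satisfies $\langle x,y\rangle^*=\langle y,x\rangle$, is positive definite, and is complete for the norm $\|x\|=\|\langle x,x\rangle\|^{1/2}$. $\mathcal{L}(E,F)$ denotes the set of bounded adjointable operators $T:E\to F$, i.e. those for which there exists $T^*:F\to E$ with $\langle Tx,y\rangle=\langle x,T^*y\rangle$ for all $x\in E$, $y\in F$. $\mathrm{Ran}$ denotes range. The Moore–Penrose inverse $T^{\dagger}$ of $T\in\mathcal{L}(E,F)$, if it exists, is the (unique) element $X\in\mathcal{L}(F,E)$ satisfying (1) $TXT=T$, (2) $XTX=X$, (3) $(TX)^*=TX$, (4) $(XT)^*=XT$. It is known that it exists in $\mathcal{L}(F,E)$ if and only if $T$ has closed range. *)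

(* Defs.v *)
From HB Require Import structures.
From mathcomp Require Import all_boot all_order all_algebra.
From mathcomp.real_closed Require Import complex.
From mathcomp Require Import boolp classical_sets reals topology normedtype.

Set Implicit Arguments.
Unset Strict Implicit.
Unset Printing Implicit Defensive.

Import Order.TTheory GRing.Theory Num.Theory.
Import numFieldNormedType.Exports.

Local Open Scope ring_scope.
Local Open Scope classical_set_scope.

(* MathComp rings have a unit, so the multiplication of a C*-algebra, which
   need not have one, is part of the mixin. *)
HB.mixin Record isCStarAlgebra (R : realType) A
    of CompleteNormedModule R[i] A := {
  cmul : A -> A -> A ;
  cstar : A -> A ;
  cmulA : forall a b c, cmul a (cmul b c) = cmul (cmul a b) c ;
  cmul_linearl : forall b (l : R[i]) (a a' : A),
    cmul (l *: a + a') b = l *: cmul a b + cmul a' b ;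
  cmul_linearr : forall a (l : R[i]) (b b' : A),
    cmul a (l *: b + b') = l *: cmul a b + cmul a b' ;
  cstarK : involutive cstar ;
  cstar_antilinear : forall (l : R[i]) (a b : A),
    cstar (l *: a + b) = l^* *: cstar a + cstar b ;
  cstarM : forall a b, cstar (cmul a b) = cmul (cstar b) (cstar a) ;
  norm_cmul : forall a b, `|cmul a b| <= `|a| * `|b| ;
  norm_cstar_cmul : forall a, `|cmul (cstar a) a| = `|a| ^+ 2
}.

#[short(type="cstarAlgType")]
HB.structure Definition CStarAlgebra (R : realType) :=
  {A of CompleteNormedModule R[i] A & isCStarAlgebra R A}.

Definition cpositive (R : realType) (A : cstarAlgType R) (a : A) : Prop :=
  exists b : A, a = cmul (cstar b) b.

(* Norm and completeness are inherited from completeNormedModType; [inner_norm]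
   says that this norm is the one induced by the inner product. Norms on
   R[i]-modules take their values in R[i]. *)
HB.mixin Record isHilbertModule (R : realType) (A : cstarAlgType R) E
    of CompleteNormedModule R[i] E := {
  ract : E -> A -> E ;
  ractDl : forall (x y : E) a, ract (x + y) a = ract x a + ract y a ;
  ractDr : forall x (a b : A), ract x (a + b) = ract x a + ract x b ;
  ractA : forall x (a b : A), ract x (cmul a b) = ract (ract x a) b ;
  ractZl : forall (l : R[i]) (x : E) a, ract (l *: x) a = l *: ract x a ;
  ractZr : forall (l : R[i]) x (a : A), ract x (l *: a) = l *: ract x a ;
  inner : E -> E -> A ;
  inner_linearr : forall x (l : R[i]) (y z : E),
    inner x (l *: y + z) = l *: inner x y + inner x z ;
  inner_ractr : forall x y a, inner x (ract y a) = cmul (inner x y) a ;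
  inner_star : forall x y, cstar (inner x y) = inner y x ;
  inner_ge0 : forall x, cpositive (inner x x) ;
  inner_eq0 : forall x, inner x x = 0 -> x = 0 ;
  inner_norm : forall x : E, `|x| = sqrtC `|inner x x|
}.

#[short(type="hilbertModType")]
HB.structure Definition HilbertModule (R : realType) (A : cstarAlgType R) :=
  {E of CompleteNormedModule R[i] E & isHilbertModule R A E}.

Arguments inner {R A _} _ _.

Section Operators.
Context (R : realType) (A : cstarAlgType R).
Implicit Types E F : hilbertModType A.

Definition is_adjoint E F (T : E -> F) (T' : F -> E) : Prop :=
  forall x y, inner (T x) y = inner x (T' y).

Definition bounded_operator E F (T : E -> F) : Prop :=
  exists M : R[i], forall x, `|T x| <= M * `|x|.

(* A-linearity of the members of L(E,F) follows from adjointability. *)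
Definition adjointable E F : set (E -> F) :=
  [set T : E -> F | [/\ linear T, bounded_operator T &
                        exists T', is_adjoint T T']].

(* The adjoint is unique when it exists; the value is 0 otherwise. *)
Definition adjoint E F (T : E -> F) : F -> E :=
  xget (fun=> 0) [set T' | is_adjoint T T'].

Definition is_moore_penrose E F (T : E -> F) (X : F -> E) : Prop :=
  [/\ adjointable X,
      T \o X \o T = T,
      X \o T \o X = X,
      adjoint (T \o X) = T \o X &
      adjoint (X \o T) = X \o T].

(* The Moore-Penrose inverse is unique when it exists; the value is 0
   otherwise. *)
Definition moore_penrose E F (T : E -> F) : F -> E :=
  xget (fun=> 0) [set X | is_moore_penrose T X].

End Operators.

Arguments adjointable {R A} E F.

Notation "T ^[*]" := (adjoint T) (at level 1, left associativity, format "T ^[*]").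
Notation "T ^†" := (moore_penrose T)
  (at level 1, left associativity, format "T ^†").

(* Main.v *)
Require Import Defs.
From mathcomp Require Import all_boot all_order all_algebra.
From mathcomp.real_closed Require Import complex.
From mathcomp Require Import boolp classical_sets reals topology normedtype.
From mathcomp Require Import sequences ring lra.
Import numFieldNormedType.Exports.
Local Open Scope ring_scope.
Local Open Scope classical_set_scope.

Set Implicit Arguments.
Unset Strict Implicit.
Unset Printing Implicit Defensive.
Import Order.TTheory GRing.Theory Num.Theory.

(** Why the equivalence holds.

    Write P = S S^† and Q = T^† T for the orthogonal projections onto the
    ranges of S and T^[*]. Once the three Moore-Penrose inverses are known to
    exist, everything is algebra with adjoints.

    - Condition (ii) forces Q P Q P = Q P, that is, Q P is idempotent, and then
      P and Q commute ([projection_commute]). The operator T P T^† is moreover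
      the projection T S (T S)^†, hence self-adjoint; multiplying
      T P T^† = (T P T^†)^[*] by T^[*] and T gives P T^[*] T S = T^[*] T S
      ([gramian_invariant]). The second half of (iii) is the same statement for
      the pair (T^[*], S^[*]), followed by an adjoint.
    - (iii) and (iv) both say that T^[*] T S has its range in that of S, and
      S S^[*] T^[*] has its range in that of T^[*].
    - Invariance of the range of S under the self-adjoint T^[*] T makes P
      commute with T^[*] T, hence with Q, and makes T P T^† self-adjoint
      ([gramian_commute], [gramian_projection_commute],
      [product_range_projection]). With the dual facts, S^† T^† satisfies the
      four Penrose equations for T S, so it is (T S)^† by uniqueness.

    The analytic content is that an adjointable T with closed range has a
    Moore-Penrose inverse ([moore_penrose_exists]); without it (T S)^† could be
    the default value 0. This reduces to T T^[*] mapping range T onto itself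
    ([adjoint_comp_range]). Closed submodules of Hilbert modules need not be
    complemented, so surjectivity cannot come from orthogonality. Instead:

    - a sliding hump argument on the complete space range T shows
      c |y| <= |T^[*] y| on range T ([closed_range_bounded_below]);
    - <y, T T^[*] y> and <y, y> being self-adjoint, the first is bounded in norm
      by <y, (T T^[*] + i t) y> for every real t ([rnorm_le_imag_add]), so that
      the operators T T^[*] + i t are bounded below uniformly in t;
    - for large t such an operator is onto, being a small perturbation of i t,
      and the uniform bound carries surjectivity down to t = 0 in steps of fixed
      length ([continuity_method]).

    The inner product is estimated through |<x, y>| <= 6 |x| |y|, which follows
    from the triangle inequality by polarization ([rnorm_inner_le]). *)

(** * Maps satisfying the predicate linear, and linear subspaces *)

Section LinearMaps.
Context (K : nzRingType) (W W' : lmodType K).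
Implicit Types f : W -> W'.

Lemma linear_funB f x y :
  linear f -> f (x - y) = f x - f y.
Proof. by move=> lf; rewrite addrC -scaleN1r lf scaleN1r addrC. Qed.

Lemma linear_fun0 f : linear f -> f 0 = 0.
Proof. by move=> lf; rewrite -(subrr 0) linear_funB// subrr. Qed.

Lemma linear_funZ f l x :
  linear f -> f (l *: x) = l *: f x.
Proof. by move=> lf; rewrite -[l *: x]addr0 lf linear_fun0// addr0. Qed.

End LinearMaps.

Section Subspaces.
Context (K : nzRingType) (W : lmodType K).
Implicit Types U : set W.

Definition subspace U :=
  U 0 /\ forall (l : K) x y, U x -> U y -> U (l *: x + y).

Lemma subspaceB U x y : subspace U -> U x -> U y -> U (x - y).
Proof. by move=> [_ sU] Ux Uy; rewrite addrC -scaleN1r; apply: sU. Qed.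

Lemma subspaceZ U (l : K) x : subspace U -> U x -> U (l *: x).
Proof. by move=> [U0 sU] Ux; rewrite -[l *: x]addr0; apply: sU. Qed.

Lemma subspace_range (W' : lmodType K) (f : W' -> W) :
  linear f -> subspace (range f).
Proof.
move=> lf; split; first by exists 0 => //; exact: linear_fun0.
by move=> l _ _ [x _ <-] [y _ <-]; exists (l *: x + y); rewrite ?lf.
Qed.

End Subspaces.

(** * Real-valued norms and geometric sequences *)

Section RealNorm.
Context (R : realType) (V : normedModType R[i]).
Implicit Types x y : V.

(** Norms on modules over R[i] are complex numbers; their real parts live in an
    ordered field where estimates can be computed. *)
Definition rnorm x : R := complex.Re `|x|.

Lemma rnormE x : `|x| = (rnorm x)%:C%C.
Proof. by rewrite /rnorm RRe_real// normr_real. Qed.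

Lemma rnorm_ge0 x : 0 <= rnorm x.
Proof. by rewrite -lecR -rnormE; exact: normr_ge0. Qed.

Lemma rnormD x y : rnorm (x + y) <= rnorm x + rnorm y.
Proof. by rewrite -lecR rmorphD/= -!rnormE ler_normD. Qed.

Lemma rnormN x : rnorm (- x) = rnorm x.
Proof. by rewrite /rnorm normrN. Qed.

Lemma rnormB x y : rnorm (x - y) <= rnorm x + rnorm y.
Proof. by rewrite -(rnormN y) rnormD. Qed.

Lemma rnormBC x y : rnorm (x - y) = rnorm (y - x).
Proof. by rewrite -rnormN opprB. Qed.

Lemma rnorm0 : rnorm 0 = 0.
Proof. by rewrite /rnorm normr0. Qed.

Lemma rnorm_le0_eq0 x : rnorm x <= 0 -> x = 0.
Proof.
move=> x0; apply/eqP; rewrite -normr_le0 rnormE.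
by rewrite lecR.
Qed.

Lemma rnormZ (l : R[i]) (r : R) x : `|l| = r%:C%C ->
  rnorm (l *: x) = r * rnorm x.
Proof.
move=> lr; apply: complexI.
by rewrite rmorphM/= -!rnormE normrZ lr.
Qed.

Lemma rnormZr (r : R) x : rnorm (r%:C%C *: x) = `|r| * rnorm x.
Proof.
by apply: rnormZ; rewrite normc_def /= expr0n addr0 sqrtr_sqr.
Qed.

End RealNorm.

Lemma le_geometric_le0 (R : realType) (a c q : R) : 0 <= q < 1 ->
  (forall n, a <= c * q ^+ n) -> a <= 0.
Proof.
move=> /andP[q0 q1] ac.
have q1' : `|q| < 1 by rewrite ger0_norm.
rewrite leNgt; apply/negP => a0.
have /cvgrPdist_lt/(_ _ a0) := cvg_geometric c q1'.
case=> N _ /(_ N (leqnn N)) /=.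
rewrite sub0r normrN => /(le_lt_trans (ler_norm _)).
by rewrite ltNge ac.
Qed.

Section Banach.
Context (R : realType) (V : completeNormedModType R[i]).

Lemma geometric_tail (u : nat -> V) (c q : R) : 0 <= q < 1 ->
  (forall n, rnorm (u n.+1 - u n) <= c * q ^+ n) ->
  forall n k, rnorm (u (n + k)%N - u n) <= c / (1 - q) * q ^+ n.
Proof.
move=> /andP[q0 q1] uc n k.
have c0 : 0 <= c by have := le_trans (rnorm_ge0 _) (uc 0%N); rewrite expr0 mulr1.
have q1' : 1 - q != 0 by lra.
elim: k n => [|k IH] n.
  rewrite addn0 subrr rnorm0 !mulr_ge0 ?exprn_ge0 ?invr_ge0//; lra.
rewrite addnS -addSn.
rewrite (_ : _ - _ = u (n.+1 + k)%N - u n.+1 + (u n.+1 - u n)); last first.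
  by rewrite addrA subrK.
apply: (le_trans (rnormD _ _)); apply: (le_trans (lerD (IH _) (uc _))).
by rewrite exprS le_eqVlt; apply/orP; left; apply/eqP; field.
Qed.

(** The explicit distance to the limit is what both uses need: the contraction
    in [surjective_perturbation] and the sliding hump in
    [closed_range_bounded_below]. *)
Lemma geometric_cvg (U : set V) (u : nat -> V) (c q : R) : closed U ->
  0 <= q < 1 -> (forall n, U (u n)) ->
  (forall n, rnorm (u n.+1 - u n) <= c * q ^+ n) ->
  exists2 l, U l & forall n, rnorm (l - u n) <= c / (1 - q) * q ^+ n.
Proof.
move=> clU q01 Uu uc.
have tail := geometric_tail q01 uc.
have : cvg (u @ \oo).
  apply: cauchy_cvg; apply: cauchy_exP => e e0.
  have eE : e = (complex.Re e)%:C%C by rewrite RRe_real// gtr0_real.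
  have [n hn] : exists n, c / (1 - q) * q ^+ n < complex.Re e.
    apply: contrapT => /forallNP h.
    have : complex.Re e <= 0.
      by apply: (le_geometric_le0 q01) => n; rewrite leNgt; apply/negP/h.
    by rewrite leNgt -ltcR -eE e0.
  exists (u n); exists n => // m /= nm.
  rewrite -ball_normE /= -normrN opprB rnormE eE ltcR.
  by rewrite -(subnKC nm); apply: le_lt_trans hn.
rewrite cvg_ex => -[l ul]; exists l.
  by apply: closed_cvg ul => //; exact: nearW.
move=> n; apply/ler_addgt0Pl => e e0.
have e0' : 0 < e%:C%C :> R[i] by rewrite ltcR.
have /cvgrPdist_le/(_ _ e0')[N _ /(_ (n + N)%N (leq_addl _ _))/=] := ul.
rewrite rnormE lecR => le.
rewrite -(subrK (u (n + N)%N) l) -addrA.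
exact: (le_trans (rnormD _ _) (lerD le (tail _ _))).
Qed.

End Banach.

(** * Surjectivity of perturbed operators on a closed subspace *)

Section Perturbation.
Context (R : realType) (V : completeNormedModType R[i]).
Implicit Types (U : set V) (L D Q : V -> V).

(** L has on U a right inverse g, which need not be linear but is Lipschitz with
    constant 1/c because L is bounded below. Hence y |-> g (z - D y) is a
    contraction of U, and its fixed point solves the equation. *)
Lemma surjective_perturbation U L D (c : R) : closed U -> subspace U -> 0 < c ->
  linear L -> linear D -> (forall y, U y -> U (D y)) ->
  (forall y, U y -> c * rnorm y <= rnorm (L y)) ->
  (forall y, U y -> rnorm (D y) <= c / 2 * rnorm y) ->
  (forall z, U z -> exists2 y, U y & L y = z) ->
  forall z, U z -> exists2 y, U y & L y + D y = z.
Proof.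
move=> clU sU c0 linL linD DU Lc Dc surjL z Uz.
have [g gP] : {g : V -> V & forall z, U z -> U (g z) /\ L (g z) = z}.
  apply: (@choice _ _ (fun z y => U z -> U y /\ L y = z)) => w.
  have [Uw|nUw] := pselect (U w); last by exists 0.
  by have [y Uy Ly] := surjL _ Uw; exists y.
pose h y := g (z - D y).
have Uh y : U y -> U (h y).
  by move=> Uy; have [] := gP (z - D y) (subspaceB sU Uz (DU _ Uy)).
have hL y : U y -> L (h y) = z - D y.
  by move=> Uy; have [] := gP (z - D y) (subspaceB sU Uz (DU _ Uy)).
have hlip x y : U x -> U y -> rnorm (h x - h y) <= 1 / 2 * rnorm (x - y).
  move=> Ux Uy; have Uxy := subspaceB sU Ux Uy.
  have := Lc _ (subspaceB sU (Uh _ Ux) (Uh _ Uy)).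
  have -> : L (h x - h y) = D (y - x).
    by rewrite !linear_funB// !hL// opprB addrC addrA subrK.
  move=> /le_trans/(_ (Dc _ (subspaceB sU Uy Ux))).
  rewrite (rnormBC y x) -mulrA ler_pM2l//; lra.
pose u n := iter n h 0.
have Uu n : U (u n) by elim: n => [|n IH]; [exact: sU.1|exact: Uh].
have uc n : rnorm (u n.+1 - u n) <= rnorm (u 1%N - u 0%N) * (1 / 2) ^+ n.
  elim: n => [|n IH]; first by rewrite expr0 mulr1.
  apply: (le_trans (hlip _ _ (Uu n.+1) (Uu n))).
  by rewrite exprS mulrCA ler_wpM2l//; lra.
have half01 : 0 <= (1 / 2 : R) < 1 by apply/andP; split; lra.
have [y Uy yu] := geometric_cvg clU half01 Uu uc.
exists y => //.
suff -> : L y = z - D y by rewrite subrK.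
rewrite -hL//; congr L.
apply/eqP; rewrite -subr_eq0; apply/eqP/rnorm_le0_eq0.
set C := _ / (1 - 1 / 2) in yu.
apply: (@le_geometric_le0 _ _ (C * 2) _ half01) => n.
rewrite (_ : y - h y = (y - u n.+1) + (h (u n) - h y)); last first.
  by rewrite -[u n.+1]/(h (u n)) addrA subrK.
apply: (le_trans (rnormD _ _)).
have := yu n.+1; have := hlip _ _ (Uu n) Uy; have := yu n.
have := rnorm_ge0 (y - u n).
rewrite (rnormBC (u n)) exprS.
have : 0 <= (1 / 2 : R) ^+ n by rewrite exprn_ge0//; lra.
move: (rnorm _) (rnorm _) (rnorm _) (_ ^+ n) => a1 a2 a3 p.
lra.
Qed.

Lemma imag_norm (t : R) : `|'i * t%:C%C : R[i]| = `|t|%:C%C.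
Proof.
by rewrite normrM normCi mul1r normc_def /= expr0n addr0 sqrtr_sqr.
Qed.

(** The operators Q + i t are bounded below by the same c for all real t, so
    surjectivity passes from s to t as soon as |t - s| <= c / 2. It holds for
    large t, where Q is a small perturbation of i t, and finitely many steps
    lead down to t = 0. *)
Lemma continuity_method U Q (c M : R) : closed U -> subspace U -> 0 < c ->
  linear Q -> (forall y, U y -> U (Q y)) ->
  (forall y, U y -> rnorm (Q y) <= M * rnorm y) ->
  (forall (t : R) y, U y -> c * rnorm y <= rnorm (('i * t%:C%C) *: y + Q y)) ->
  forall z, U z -> exists2 y, U y & Q y = z.
Proof.
move=> clU sU c0 linQ QU QM Qc.
pose surj t := forall z, U z -> exists2 y, U y & ('i * t%:C%C) *: y + Q y = z.
have lin_scale (a : R[i]) : linear (fun y : V => a *: y).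
  by move=> l x y; rewrite scalerDr !scalerA mulrC.
have lin_Qt t : linear (fun y => ('i * t%:C%C) *: y + Q y).
  by move=> l x y; rewrite linQ lin_scale scalerDr addrACA.
have step (s t : R) : `|t - s| <= c / 2 -> surj s -> surj t.
  move=> ts ss z Uz.
  have [|||y Uy <-] := @surjective_perturbation U _
    (fun y => ('i * (t - s)%:C%C) *: y) c
    clU sU c0 (lin_Qt s) (lin_scale _) _ _ _ ss z Uz.
  - by move=> y; apply: subspaceZ.
  - by move=> y; apply: Qc.
  - move=> y Uy; rewrite (rnormZ _ (imag_norm _)).
    by rewrite ler_wpM2r ?rnorm_ge0.
  - exists y => //; rewrite addrAC -scalerDl -mulrDr.
    by rewrite -rmorphD/= [s + _]addrC subrK.
(* the descent starts at t = N * (c / 2), and t >= 2 * (1 + |M|) makes the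
   perturbation Q at most half of the lower bound t of i t *)
pose N := (Num.truncn (2 * (2 * (1 + `|M|)) / c)).+1.
have start : surj (N%:R * (c / 2)).
  have NM : 2 * (1 + `|M|) <= N%:R * (c / 2).
    have := truncnS_gt (2 * (2 * (1 + `|M|)) / c); rewrite -/N ltr_pdivrMr//.
    lra.
  set t := _ * (c / 2) in NM *.
  have M0 := normr_ge0 M.
  have t0 : 0 < t by lra.
  apply: (@surjective_perturbation U _ Q t) => //.
  - by move=> y Uy; rewrite (rnormZ _ (imag_norm _)) gtr0_norm.
  - move=> y Uy; apply: (le_trans (QM _ Uy)).
    by rewrite ler_wpM2r ?rnorm_ge0//; have := ler_norm M; lra.
  - move=> z Uz; exists (('i * t%:C%C)^-1 *: z); first exact: subspaceZ.
    rewrite scalerA divff ?scale1r// mulf_neq0 ?neq0Ci//.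
    by rewrite (inj_eq (@complexI _)) gt_eqF.
have : surj 0.
  elim: N start => [|n IH]; first by rewrite mul0r.
  move=> sn; apply/IH/step/sn.
  rewrite -mulrBl -addn1 natrD opprD addrA subrr sub0r mulN1r normrN.
  by rewrite gtr0_norm; lra.
by move=> s0 z /s0[y Uy yz]; exists y => //; rewrite -yz mulr0 scale0r add0r.
Qed.

End Perturbation.

(** * Norm estimates in C*-algebras and Hilbert modules *)

Section StarNorm.
Context (R : realType) (A : cstarAlgType R).
Implicit Types a b : A.

Lemma cstar0 : cstar (0 : A) = 0.
Proof.
have := cstar_antilinear 1 (0 : A) 0.
by rewrite conjC1 !scale1r addr0 -{1}[cstar 0]addr0 => /addrI.
Qed.

Lemma cstarD a b : cstar (a + b) = cstar a + cstar b.
Proof. by have := cstar_antilinear 1 a b; rewrite conjC1 !scale1r. Qed.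

Lemma cstarZ (l : R[i]) a : cstar (l *: a) = l^* *: cstar a.
Proof. by rewrite -[l *: a]addr0 cstar_antilinear cstar0 addr0. Qed.

(** The C*-identity gives |a|^2 = |a^* a| <= |a^*| |a|, and the star is an
    involution. *)
Lemma rnorm_cstar a : rnorm (cstar a) = rnorm a.
Proof.
have le b : rnorm b <= rnorm (cstar b).
  have [->|b0] := eqVneq b 0; first by rewrite cstar0.
  have : `|b| ^+ 2 <= `|cstar b| * `|b| by rewrite -norm_cstar_cmul norm_cmul.
  by rewrite expr2 ler_pM2r ?normr_gt0// !rnormE lecR.
by apply/eqP; rewrite eq_le le andbT -{2}(cstarK a) le.
Qed.

(** a is the self-adjoint part of i t b + a, and the star is isometric. *)
Lemma rnorm_le_imag_add a b (t : R) : cstar a = a -> cstar b = b ->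
  rnorm a <= rnorm (('i * t%:C%C) *: b + a).
Proof.
move=> sa sb; set z := _ + a.
have zz : z + cstar z = 2%:C%C *: a.
  rewrite /z cstarD cstarZ sa sb addrACA -scalerDl.
  rewrite rmorphM /= conjCi conj_Creal ?complex_real// mulNr subrr scale0r add0r.
  by rewrite -mulr2n -scaler_nat rmorph_nat.
have := rnormD z (cstar z); rewrite zz rnormZr rnorm_cstar.
rewrite ger0_norm; lra.
Qed.

End StarNorm.

Section Inner.
Context (R : realType) (A : cstarAlgType R) (E : hilbertModType A).
Implicit Types x y z : E.

Lemma inner_linear x : linear (inner x : E -> A).
Proof. by move=> l y z; exact: inner_linearr. Qed.

Lemma innerZDl (l : R[i]) x y z :
  inner (l *: x + y) z = l^* *: inner x z + inner y z.
Proof. by rewrite -inner_star inner_linearr cstar_antilinear !inner_star. Qed.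

Lemma inner0l x : inner 0 x = 0.
Proof. by rewrite -inner_star (linear_fun0 (inner_linear x)) cstar0. Qed.

Lemma rnorm_inner x : rnorm (inner x x) = rnorm x ^+ 2.
Proof.
apply: complexI; rewrite rmorphXn/= -!rnormE inner_norm.
by rewrite sqrtCK.
Qed.

Lemma inner0r x : inner x 0 = 0.
Proof. exact: linear_fun0 (inner_linear x). Qed.

Lemma innerBr x y z : inner x (y - z) = inner x y - inner x z.
Proof. exact: (linear_funB _ _ (inner_linear x)). Qed.

Lemma innerZr x (l : R[i]) y : inner x (l *: y) = l *: inner x y.
Proof. exact: (linear_funZ _ _ (inner_linear x)). Qed.

Lemma inner_ext x y : (forall z, inner z x = inner z y) -> x = y.
Proof.
move=> xy; apply/eqP; rewrite -subr_eq0; apply/eqP/inner_eq0.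
by rewrite innerBr xy subrr.
Qed.

Lemma innerDr x y z : inner x (y + z) = inner x y + inner x z.
Proof. by rewrite -[y]scale1r inner_linearr !scale1r. Qed.

Lemma innerDl x y z : inner (x + y) z = inner x z + inner y z.
Proof. by rewrite -inner_star innerDr cstarD !inner_star. Qed.

Lemma inner_add_swap x y : inner x y + inner y x =
  inner (x + y) (x + y) - inner x x - inner y y.
Proof.
rewrite innerDr !innerDl addrA (addrAC _ _ (- inner x x)) addrK.
by rewrite -(addrA (inner x x)) (addrC (inner x x)) addrK addrC.
Qed.

(** The sum <x,y> + <y,x> is bounded by polarization and the triangle
    inequality, and <x,y> is recovered from that sum and its analogue for
    (x, i y). The resulting bound (|x| + |y|)^2 + |x|^2 + |y|^2 is 6 |x| |y|
    when |x| = |y|, a case reached by rescaling x. *)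
Lemma rnorm_inner_le x y : rnorm (inner x y) <= 6 * rnorm x * rnorm y.
Proof.
have sym (u v : E) : rnorm (inner u v + inner v u) <=
    (rnorm u + rnorm v) ^+ 2 + rnorm u ^+ 2 + rnorm v ^+ 2.
  rewrite inner_add_swap; apply: (le_trans (rnormB _ _)).
  rewrite rnorm_inner lerD2r.
  apply: (le_trans (rnormB _ _)); rewrite !rnorm_inner lerD2r.
  by rewrite ler_sqr ?nnegrE ?rnorm_ge0 ?addr_ge0 ?rnorm_ge0// rnormD.
have ri (V : normedModType R[i]) (v : V) : rnorm ('i *: v) = rnorm v.
  by rewrite (@rnormZ _ _ _ 1) ?mul1r// normCi.
have bound (u v : E) : rnorm (inner u v) <=
    (rnorm u + rnorm v) ^+ 2 + rnorm u ^+ 2 + rnorm v ^+ 2.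
  have e : 2%:C%C *: inner u v = (inner u v + inner v u) -
      'i *: (inner u ('i *: v) + inner ('i *: v) u).
    rewrite -(inner_star u ('i *: v)) innerZr.
    rewrite cstarZ inner_star conjCi scalerDr !scalerA mulrN -expr2 sqrCi opprK.
    rewrite scaleN1r scale1r opprD opprK addrACA subrr addr0 -mulr2n.
    by rewrite -[RHS]scaler_nat rmorph_nat.
  have := rnormB (inner u v + inner v u)
    ('i *: (inner u ('i *: v) + inner ('i *: v) u)).
  rewrite -e rnormZr ri; have := sym u v; have := sym u ('i *: v); rewrite ri.
  by rewrite ger0_norm//; lra.
have [x0|x0] := leP (rnorm x) 0.
  by rewrite (rnorm_le0_eq0 x0) inner0l !rnorm0 mulr0 mul0r.
have [y0|y0] := leP (rnorm y) 0.
  by rewrite (rnorm_le0_eq0 y0) inner0r !rnorm0 mulr0.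
have := bound ((rnorm y / rnorm x)%:C%C *: x) y.
rewrite -[_ *: x]addr0 innerZDl inner0l !addr0 conj_Creal ?complex_real// !rnormZr.
rewrite ger0_norm ?divr_ge0 ?rnorm_ge0// divfK ?gt_eqF//.
rewrite -mulrA mulrC -ler_pdivlMr; last by rewrite divr_gt0.
move=> /le_trans; apply; rewrite le_eqVlt; apply/orP; left; apply/eqP.
by field; rewrite !gt_eqF.
Qed.

End Inner.

(** * Adjoints *)

Section Adjoints.
Context (R : realType) (A : cstarAlgType R).
Implicit Types E F G : hilbertModType A.

Lemma is_adjoint_sym E F (T : E -> F) T' : is_adjoint T T' -> is_adjoint T' T.
Proof. by move=> TT' y x; rewrite -inner_star -TT' inner_star. Qed.

Lemma is_adjoint_comp E F G (S : E -> F) S' (T : F -> G) T' :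
  is_adjoint S S' -> is_adjoint T T' -> is_adjoint (T \o S) (S' \o T').
Proof. by move=> SS' TT' x y; rewrite /= TT' SS'. Qed.

(** This is how an equation between operators is turned into the equation
    between their adjoints. *)
Lemma is_adjoint_ext E F (T1 T2 : E -> F) T1' T2' :
  is_adjoint T1 T1' -> is_adjoint T2 T2' -> T1 =1 T2 -> T1' =1 T2'.
Proof.
by move=> a1 a2 e y; apply: inner_ext => x; rewrite -a1 -a2 e.
Qed.

Lemma is_adjoint_linear E F (T : E -> F) T' : is_adjoint T T' -> linear T'.
Proof.
move=> TT' l x y; apply: inner_ext => z.
by rewrite -TT' !inner_linearr !TT'.
Qed.

Lemma adjointP E F (T : E -> F) : adjointable E F T -> is_adjoint T T^[*].
Proof.
move=> [_ _ [T' TT']].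
by apply: (@xgetPex _ _ [set X | is_adjoint T X]); exists T'.
Qed.

Lemma adjointE E F (T : E -> F) T' : is_adjoint T T' -> T^[*] = T'.
Proof.
move=> TT'; apply/funext/(@is_adjoint_ext _ _ T T _ T') => //.
by apply: (@xgetPex _ _ [set X | is_adjoint T X]); exists T'.
Qed.

Lemma rnorm_bounded E F (T : E -> F) : bounded_operator T ->
  exists2 M : R, 0 <= M & forall x, rnorm (T x) <= M * rnorm x.
Proof.
move=> [[M M'] TM]; exists `|M| => // x.
have := TM x; rewrite !rnormE lecE => /andP[_] /=.
rewrite mulr0 subr0 => /le_trans; apply.
by rewrite ler_wpM2r ?rnorm_ge0 ?ler_norm.
Qed.

Lemma rnorm_adjoint_le E F (T : E -> F) T' (M : R) : is_adjoint T T' ->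
  0 <= M -> (forall x, rnorm (T x) <= M * rnorm x) ->
  forall y, rnorm (T' y) <= 6 * M * rnorm y.
Proof.
move=> /is_adjoint_sym T'T M0 TM y.
have [y0|y0] := leP (rnorm (T' y)) 0.
  by apply: (le_trans y0); rewrite !mulr_ge0 ?rnorm_ge0.
rewrite -(ler_pM2r y0) -[leLHS]expr2 -rnorm_inner T'T.
apply: (le_trans (rnorm_inner_le _ _)).
by rewrite -!mulrA ler_pM2l// mulrCA ler_wpM2l ?rnorm_ge0.
Qed.

End Adjoints.

(** * Operators with closed range *)

Section ClosedRange.
Context (R : realType) (A : cstarAlgType R) (E F : hilbertModType A).
Context (T : E -> F) (T' : F -> E).
Context (linT : linear T) (TT' : is_adjoint T T') (clT : closed (range T)).

(** Sliding hump, playing the role of the open mapping theorem. If the bound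
    fails there are unit vectors v_n in range T with |T' v_n| < q^n / (n + 1).
    Adding or subtracting q^n v_n at step n builds a convergent sequence with
    limit T x in the closed set range T and with |<v_n, T x>| of order q^n.
    But <v_n, T x> = <T' v_n, x> is of order q^n / (n + 1). *)
Lemma closed_range_bounded_below :
  exists2 c : R, 0 < c & forall y, range T y -> c * rnorm y <= rnorm (T' y).
Proof.
apply: contrapT => nbound.
(* q is chosen so that 6 * q / (1 - q) = 1 / 2: by rnorm_inner_le, the terms
   after the n-th then change |<v_n, _>| by at most q ^+ n / 2 *)
pose q : R := 1 / 13; have q0 : 0 < q by rewrite /q; lra.
have q01 : 0 <= q < 1 by rewrite /q; apply/andP; split; lra.
have small (c : R) : 0 < c -> exists v,
    [/\ range T v, rnorm v = 1 & rnorm (T' v) < c].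
  move=> c0; apply: contrapT => nv; apply: nbound; exists c => // y Ty.
  rewrite leNgt; apply/negP => yc.
  have y0 : 0 < rnorm y.
    rewrite ltNge; apply/negP => /rnorm_le0_eq0 ye.
    move: yc; rewrite ye (linear_fun0 (is_adjoint_linear TT')).
    by rewrite !rnorm0 mulr0 ltxx.
  apply: nv; exists ((rnorm y)^-1%:C%C *: y); split.
  - exact: subspaceZ (subspace_range linT) Ty.
  - by rewrite rnormZr ger0_norm ?invr_ge0 ?rnorm_ge0// mulVf ?gt_eqF.
  - rewrite (linear_funZ _ _ (is_adjoint_linear TT')) rnormZr.
    rewrite ger0_norm ?invr_ge0 ?rnorm_ge0// mulrC ltr_pdivrMr//.
have /choice[v vP] n : exists v, [/\ range T v, rnorm v = 1 &
    rnorm (T' v) < q ^+ n / n.+1%:R].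
  by apply: small; rewrite divr_gt0// exprn_gt0.
pose w n := (q ^+ n)%:C%C *: v n.
pose next n z :=
  if q ^+ n <= rnorm (inner (v n) (z + w n)) then z + w n else z - w n.
pose z := fix z n := if n is m.+1 then next m (z m) else 0.
have zS n : z n.+1 = next n (z n) by [].
have qn0 n : 0 < q ^+ n by rewrite exprn_gt0.
have wq n : rnorm (w n) = q ^+ n.
  by have [_ v1 _] := vP n; rewrite rnormZr v1 mulr1 gtr0_norm.
have Tz n : range T (z n).
  elim: n => [|n IH]; first exact: (subspace_range linT).1.
  have Tw : range T (w n).
    by apply: subspaceZ (subspace_range linT) _; have [] := vP n.
  rewrite zS /next; case: ifP => _; last first.
    exact: subspaceB (subspace_range linT) IH Tw.
  by rewrite -[z n]scale1r; apply: (subspace_range linT).2.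
have zc n : rnorm (z n.+1 - z n) <= 1 * q ^+ n.
  rewrite mul1r zS /next; case: ifP => _; rewrite addrAC subrr add0r ?rnormN wq//.
(* <v_n, z_n + w_n> and <v_n, z_n - w_n> differ by 2 q^n <v_n, v_n>, of norm
   2 q^n, so one of them has norm at least q^n *)
have zbig n : q ^+ n <= rnorm (inner (v n) (z n.+1)).
  rewrite zS /next; case: ifPn => //; rewrite -ltNge => lt.
  have [_ v1 _] := vP n.
  have : rnorm (inner (v n) (z n + w n) - inner (v n) (z n - w n)) = 2 * q ^+ n.
    rewrite innerDr innerBr opprB addrC addrA.
    rewrite subrK -innerDr -mulr2n -scaler_nat -(rmorph_nat (real_complex R)).
    rewrite innerZr rnormZr.
    rewrite /w innerZr rnormZr rnorm_inner v1.
    by rewrite expr1n mulr1 !gtr0_norm.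
  have := rnormB (inner (v n) (z n + w n)) (inner (v n) (z n - w n)).
  by move=> + e; rewrite e; lra.
have [_ [x _ <-] xz] := geometric_cvg clT q01 Tz zc.
have bound n : n.+1%:R <= 12 * rnorm x.
  have [_ v1 Tv] := vP n.
  have := rnormB (inner (v n) (T x)) (inner (v n) (T x - z n.+1)).
  rewrite -innerBr opprB addrC subrK.
  move=> /(le_trans (zbig n)).
  rewrite -(is_adjoint_sym TT').
  have := rnorm_inner_le (v n) (T x - z n.+1); rewrite v1 mulr1.
  have := xz n.+1; rewrite exprS.
  have := rnorm_inner_le (T' (v n)) x.
  rewrite ltr_pdivlMr// in Tv.
  have {}Tv : 6 * rnorm (T' (v n)) * rnorm x * n.+1%:R <= 6 * rnorm x * q ^+ n.
    rewrite (_ : _ * n.+1%:R = 6 * rnorm x * (rnorm (T' (v n)) * n.+1%:R)).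
      2: by ring.
    by rewrite ler_wpM2l ?mulr_ge0 ?rnorm_ge0// ltW.
  have n0 : 0 < n.+1%:R :> R by [].
  move: Tv (qn0 n) n0 (rnorm_ge0 x) (rnorm_ge0 (T x - z n.+1)).
  rewrite (_ : 1 / (1 - q) = 13 / 12) /q; last by field.
  set p := (1 / 13) ^+ n; set N := n.+1%:R.
  set a := rnorm (T' _) => Tv p0 N0 x0 d0 h1 h2 h3 h4.
  have : p <= 2 * (6 * a * rnorm x) by lra.
  nra.
have := truncnS_gt (12 * rnorm x); rewrite ltNge => /negP; apply.
exact: bound.
Qed.

Lemma rnorm_inner_adjoint_comp y : rnorm (inner y (T (T' y))) = rnorm (T' y) ^+ 2.
Proof. by rewrite -(is_adjoint_sym TT') rnorm_inner. Qed.

(** The lower bound demanded by [continuity_method] is c^2 / 6, because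
    c^2 |y|^2 <= |T' y|^2 = |<y, T T' y>| <= |<y, (T T' + i t) y>|
    <= 6 |y| |(T T' + i t) y|. *)
Lemma adjoint_comp_range : bounded_operator T ->
  forall z, range T z -> exists2 y, range T y & T (T' y) = z.
Proof.
move=> /rnorm_bounded[M M0 TM].
have [c c0 Tc] := closed_range_bounded_below.
have T'M := rnorm_adjoint_le TT' M0 TM.
apply: (@continuity_method _ F (range T) (T \o T')
  (c ^+ 2 / 6) (M * (6 * M))) => //.
- exact: subspace_range.
- by rewrite divr_gt0// exprn_gt0.
- by move=> l x y /=; rewrite (is_adjoint_linear TT') linT.
- by move=> y _; apply: (le_trans (TM _)); rewrite -mulrA ler_wpM2l.
- move=> t y Ty; have [y0|y0] := leP (rnorm y) 0.
    by rewrite (rnorm_le0_eq0 y0) rnorm0 mulr0 rnorm_ge0.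
  have sa : cstar (inner y (T (T' y))) = inner y (T (T' y)).
    by rewrite inner_star TT' (is_adjoint_sym TT').
  have := rnorm_le_imag_add t sa (inner_star y y).
  rewrite -innerZr -innerDr rnorm_inner_adjoint_comp.
  move=> /le_trans/(_ (rnorm_inner_le _ _)).
  have := Tc _ Ty; rewrite /=; set r := rnorm (_ + _) => Tcy le.
  have : (c * rnorm y) ^+ 2 <= rnorm (T' y) ^+ 2.
    by rewrite ler_sqr ?nnegrE ?mulr_ge0 ?rnorm_ge0// ltW.
  by move=> /le_trans/(_ le); rewrite -(ler_pM2r y0 _ r); lra.
Qed.

End ClosedRange.

(** * Existence of the Moore-Penrose inverse *)

Section MoorePenroseExistence.
Context (R : realType) (A : cstarAlgType R).
Implicit Types E F : hilbertModType A.

Lemma adjoint_comp_eq0 E F (T : E -> F) T' x :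
  is_adjoint T T' -> T' (T x) = 0 -> T x = 0.
Proof.
move=> TT' e; apply: inner_eq0.
by rewrite TT' e inner0r.
Qed.

(** Both <P x, w> and <x, P w> equal <P x, P w>. *)
Lemma projection_self_adjoint E (P : E -> E) :
  (forall x w, inner (P x) (w - P w) = 0) -> is_adjoint P P.
Proof.
move=> orth.
have e x w : inner (P x) w = inner (P x) (P w).
  by apply/eqP; rewrite -subr_eq0 -innerBr orth.
by move=> x w; rewrite e -inner_star -e inner_star.
Qed.

(** X z is the solution x in range T' of the normal equation T' T x = T' z; it
    is found by solving T T' y = T T' z and then T T' y' = y in range T, and
    taking x = T' y'. It is unique because T' T x = 0 implies T x = 0, and for
    x in range T' the latter implies x = 0. The adjoint Y of X is obtained in
    the same way, from T T' (Y u) = T u. The bound on Y comes from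
    c |Y u| <= |T' (Y u)| and from T' (Y u) being the projection of u, and the
    bound on X follows by duality. *)
Lemma moore_penrose_exists E F (T : E -> F) : adjointable E F T ->
  closed (range T) -> exists X, is_moore_penrose T X.
Proof.
move=> hT clT; have [linT bT _] := hT.
have TT' := adjointP hT; set T' := T^[*] in TT'.
have T'T := is_adjoint_sym TT'.
have linT' := is_adjoint_linear TT'.
have solve := adjoint_comp_range linT TT' clT bT.
have inj x1 x2 : T' (T x1) = T' (T x2) -> T x1 = T x2.
  move=> e; apply/eqP; rewrite -subr_eq0 -linear_funB//; apply/eqP.
  by apply: (adjoint_comp_eq0 TT'); rewrite !linear_funB// e subrr.
have inj' y1 y2 : T (T' y1) = T (T' y2) -> T' y1 = T' y2.
  move=> e; apply/eqP; rewrite -subr_eq0 -linear_funB//; apply/eqP.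
  by apply: (adjoint_comp_eq0 T'T); rewrite !linear_funB// e subrr.
have /choice[X XP] z : exists x, range T' x /\ T' (T x) = T' z.
  have [|_ [x0 _ <-] e1] := solve (T (T' z)); first by exists (T' z).
  have [|y _ e2] := solve (T x0); first by exists x0.
  by exists (T' y); split; [exists y|rewrite e2; apply: inj'].
have /choice[Y YP] u : exists y, range T y /\ T (T' y) = T u.
  by have [|y Ty e] := solve (T u); [exists u|exists y].
have XY : is_adjoint X Y.
  move=> z u; have [[y _ yX] eX] := XP z; have [[x _ xY] eY] := YP u.
  by rewrite -yX T'T -eY -T'T -TT' yX -xY -T'T eX T'T.
have TXT x : T (X (T x)) = T x by apply: inj; have [] := XP (T x).
have adjX : adjointable F E X.
  have [c c0 Tc] := closed_range_bounded_below linT TT' clT.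
  split; [exact: is_adjoint_linear (is_adjoint_sym XY)| |by exists Y].
  have YM u : rnorm (Y u) <= 6 / c * rnorm u.
    have [TY eY] := YP u.
    rewrite mulrAC ler_pdivlMr// mulrC.
    apply: (le_trans (Tc _ TY)).
    have [t0|t0] := leP (rnorm (T' (Y u))) 0.
      by apply: (le_trans t0); rewrite mulr_ge0 ?rnorm_ge0.
    rewrite -(ler_pM2r t0) -[leLHS]expr2 -rnorm_inner T'T eY -T'T.
    by apply: (le_trans (rnorm_inner_le _ _)); rewrite mulrAC.
  have c6 : 0 <= 6 / c by rewrite divr_ge0// ltW.
  exists (6 * (6 / c))%:C%C => z.
  rewrite !rnormE -rmorphM/= lecR.
  exact: (rnorm_adjoint_le (is_adjoint_sym XY) c6 YM).
exists X; split => //.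
- by apply/funext => x; exact: TXT.
- apply/funext => z /=; have [[y _ yX] _] := XP z.
  have [[y' _ y'X] _] := XP (T (X z)).
  by rewrite -y'X -[RHS]yX; apply: inj'; rewrite y'X yX TXT.
- apply/adjointE/projection_self_adjoint => z w /=.
  have [_ eX] := XP w.
  by rewrite TT' linear_funB// eX subrr inner0r.
- apply/adjointE/projection_self_adjoint => x w /=.
  have [[y _ <-] _] := XP (T x).
  by rewrite T'T linear_funB// TXT subrr inner0r.
Qed.

End MoorePenroseExistence.

(** * Algebra of Penrose equations *)

Section PenroseAlgebra.
Context (R : realType) (A : cstarAlgType R).
Implicit Types E F G : hilbertModType A.

(** The Penrose equations in pointwise form, with the adjoints T' and X' as
    explicit data. Self-adjointness of T X and X T is recorded as
    T X = X' T' and X T = T' X', which makes the record symmetric under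
    exchanging (T, X) with (T', X'). *)
Record penrose E F (T : E -> F) (T' : F -> E) (X : F -> E) (X' : E -> F) : Prop :=
  Penrose {
    penrose_adj : is_adjoint T T' ;
    penrose_adjX : is_adjoint X X' ;
    penroseK : forall x, T (X (T x)) = T x ;
    penroseXK : forall y, X (T (X y)) = X y ;
    penroseTX : forall y, T (X y) = X' (T' y) ;
    penroseXT : forall x, X (T x) = T' (X' x) }.

Lemma moore_penrose_penrose E F (T : E -> F) X :
  adjointable E F T -> is_moore_penrose T X -> penrose T T^[*] X X^[*].
Proof.
move=> /adjointP TT' [/adjointP XX' TXT XTX TX XT].
split => //.
- by move=> x; rewrite -[RHS](congr1 (@^~ x) TXT).
- by move=> y; rewrite -[RHS](congr1 (@^~ y) XTX).
- move=> y; rewrite -[LHS](congr1 (@^~ y) TX).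
  by rewrite (adjointE (is_adjoint_comp XX' TT')).
- move=> y; rewrite -[LHS](congr1 (@^~ y) XT).
  by rewrite (adjointE (is_adjoint_comp TT' XX')).
Qed.

Lemma moore_penroseP E F (T : E -> F) : adjointable E F T ->
  closed (range T) -> penrose T T^[*] T^† (T^†)^[*].
Proof.
move=> hT clT; apply: moore_penrose_penrose => //.
have [X TX] := moore_penrose_exists hT clT.
by apply: (@xgetPex _ _ [set X | is_moore_penrose T X]); exists X.
Qed.

(** This duality halves the work below: each fact about the pair (S, T) is also
    applied to (T', S'). *)
Lemma penrose_dual E F (T : E -> F) T' X X' :
  penrose T T' X X' -> penrose T' T X' X.
Proof.
case=> TT' XX' K XK TX XT; split.
- exact: is_adjoint_sym.
- exact: is_adjoint_sym.
- apply: (is_adjoint_ext _ TT' K).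
  exact: is_adjoint_comp TT' (is_adjoint_comp XX' TT').
- apply: (is_adjoint_ext _ XX' XK).
  exact: is_adjoint_comp XX' (is_adjoint_comp TT' XX').
- by [].
- by [].
Qed.

Lemma penrose_range_proj E F (T : E -> F) T' X X' :
  penrose T T' X X' -> is_adjoint (T \o X) (T \o X).
Proof.
move=> p x y.
by rewrite (is_adjoint_comp (penrose_adjX p) (penrose_adj p)) /= -(penroseTX p).
Qed.

Lemma penrose_corange_proj E F (T : E -> F) T' X X' :
  penrose T T' X X' -> is_adjoint (X \o T) (X \o T).
Proof.
move=> p x y; have := penrose_range_proj (penrose_dual p) x y.
by rewrite /= -!(penroseXT p).
Qed.

(** For v = Q P x - P Q P x one has P v = 0 and Q v = 0, hence
    <v, v> = <Q v, P x> - <P v, Q P x> = 0. So Q P = P Q P is self-adjoint. *)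
Lemma projection_commute E (P Q : E -> E) :
  is_adjoint P P -> is_adjoint Q Q ->
  (forall x, P (P x) = P x) -> (forall x, Q (Q x) = Q x) ->
  (forall x, Q (P (Q (P x))) = Q (P x)) -> forall x, P (Q x) = Q (P x).
Proof.
move=> PP QQ Pid Qid QPQP.
have [linP linQ] := (is_adjoint_linear PP, is_adjoint_linear QQ).
have QP x : Q (P x) = P (Q (P x)).
  apply/eqP; rewrite -subr_eq0; apply/eqP/inner_eq0.
  set v := _ - _.
  have Pv : P v = 0 by rewrite linear_funB// Pid subrr.
  have Qv : Q v = 0 by rewrite linear_funB// Qid QPQP subrr.
  by rewrite {2}/v innerBr -QQ Qv inner0l sub0r -PP Pv inner0l oppr0.
move=> x; rewrite [RHS]QP.
apply: (@is_adjoint_ext _ _ _ _ (Q \o P) (P \o (Q \o P))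
  (P \o Q) (P \o Q \o P)) QP x.
  exact: is_adjoint_comp.
exact: is_adjoint_comp (is_adjoint_comp PP QQ) PP.
Qed.

(** T X and T Z are self-adjoint projections with the same range, so they
    coincide; dually X T = Z T, and X = X T X = Z T Z = Z. *)
Lemma penrose_unique E F (T : E -> F) T' X X' Z Z' :
  penrose T T' X X' -> penrose T T' Z Z' -> X =1 Z.
Proof.
have range_proj E1 E2 (U : E1 -> E2) U' Y Y' W W' :
    penrose U U' Y Y' -> penrose U U' W W' -> forall z, U (Y z) = U (W z).
  move=> p q z; rewrite -[RHS](penroseK p).
  apply: (is_adjoint_ext (penrose_range_proj p)
    (is_adjoint_comp (penrose_range_proj p) (penrose_range_proj q))) => y /=.
  by rewrite (penroseK q).
move=> p q z.
rewrite -(penroseXK p) (range_proj _ _ _ _ _ _ _ _ p q).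
rewrite (penroseXT p).
rewrite (range_proj _ _ _ _ _ _ _ _ (penrose_dual p) (penrose_dual q)).
by rewrite -(penroseXT q) (penroseXK q).
Qed.

Section Product.
Context E F G (S : E -> F) (S' X : F -> E) (X' : E -> F).
Context (T : F -> G) (T' Y : G -> F) (Y' : F -> G).
Context (pS : penrose S S' X X') (pT : penrose T T' Y Y').

(** With P = S X and Q = Y T, multiplying T P Y = Y' P T' by T' on the left
    and T S on the right gives T' T P Q S = Q P T' T S, where commutativity
    absorbs Q. *)
Lemma gramian_invariant :
  (forall w, S (X (Y (T w))) = Y (T (S (X w)))) ->
  (forall z, T (S (X (Y z))) = Y' (S (X (T' z)))) ->
  forall x, S (X (T' (T (S x)))) = T' (T (S x)).
Proof.
move=> comm sa x; have pT' := penrose_dual pT.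
have := congr1 T' (sa (T (S x))).
rewrite comm (penroseK pT) (penroseK pS) -(penroseXT pT) -comm.
by rewrite (penroseXT pT) (penroseK pT') => <-.
Qed.

(** A subspace invariant under a self-adjoint operator reduces it: the
    hypothesis gives T' T P = P T' T P with P = S X, and the right-hand side is
    self-adjoint. *)
Lemma gramian_commute : (forall x, S (X (T' (T (S x)))) = T' (T (S x))) ->
  forall w, S (X (T' (T w))) = T' (T (S (X w))).
Proof.
move=> inv w; rewrite -[RHS]inv.
have PP := penrose_range_proj pS.
have TT := is_adjoint_comp (penrose_adj pT) (is_adjoint_sym (penrose_adj pT)).
apply: (is_adjoint_ext (is_adjoint_comp PP TT)
  (is_adjoint_comp (is_adjoint_comp PP TT) PP)) => y /=.
by rewrite inv.
Qed.

(** Q = Y T equals Y Y' T' T, so commuting with T' T gives Q P = Q P Q, which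
    is self-adjoint. *)
Lemma gramian_projection_commute :
  (forall x, S (X (T' (T (S x)))) = T' (T (S x))) ->
  forall w, S (X (Y (T w))) = Y (T (S (X w))).
Proof.
move=> /gramian_commute inv.
have PP := penrose_range_proj pS.
have QQ := penrose_corange_proj pT.
have Qgram w : Y (T w) = Y (Y' (T' (T w))).
  by rewrite -(penroseTX pT) (penroseK pT).
have QPQ x : Y (T (S (X x))) = Y (T (S (X (Y (T x))))).
  by rewrite !Qgram -!inv -Qgram (penroseK pT).
move=> w; rewrite [RHS]QPQ.
apply: (is_adjoint_ext (is_adjoint_comp PP QQ)
  (is_adjoint_comp QQ (is_adjoint_comp PP QQ))) => y /=.
exact: QPQ.
Qed.

(** T P Y = T Y T P Y = Y' T' T P Y = Y' P T' T Y = Y' P T', by moving P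
    across T' T. *)
Lemma product_range_projection :
  (forall x, S (X (T' (T (S x)))) = T' (T (S x))) ->
  forall z, T (S (X (Y z))) = Y' (S (X (T' z))).
Proof.
move=> inv z; have pT' := penrose_dual pT.
rewrite -[LHS](penroseK pT) [LHS](penroseTX pT) -(gramian_commute inv).
by rewrite (penroseTX pT) (penroseK pT').
Qed.

End Product.

Section ReverseOrder.
Context E F G (S : E -> F) (S' X : F -> E) (X' : E -> F).
Context (T : F -> G) (T' Y : G -> F) (Y' : F -> G).
Context (pS : penrose S S' X X') (pT : penrose T T' Y Y').

Lemma reverse_order_invariant :
  (forall x, S (X (T' (T (S x)))) = T' (T (S x))) ->
  (forall z, Y (T (S (S' (T' z)))) = S (S' (T' z))) ->
  penrose (T \o S) (S' \o T') (X \o Y) (Y' \o X').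
Proof.
move=> inv inv'.
have comm := gramian_projection_commute pS pT inv.
split=> /=.
- exact: is_adjoint_comp (penrose_adj pS) (penrose_adj pT).
- exact: is_adjoint_comp (penrose_adjX pT) (penrose_adjX pS).
- by move=> x; rewrite comm (penroseK pT) (penroseK pS).
- by move=> z; rewrite -comm (penroseXK pS) (penroseXK pT).
- move=> z; rewrite (product_range_projection pS pT inv).
  by rewrite (penroseTX pS).
- move=> x; rewrite (penroseXT pT).
  apply/esym/(product_range_projection (penrose_dual pT) (penrose_dual pS)).
  by move=> z; rewrite -(penroseXT pT) inv'.
Qed.

(** The first hypothesis yields Q P Q P = Q P for P = S X and Q = Y T, hence
    commutativity, and self-adjointness of T P Y; the second yields
    self-adjointness of X Q S. The two conclusions are then [gramian_invariant]
    for (S, T) and for (T', S'). *)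
Lemma invariant_of_projections Z Z' :
  penrose (T \o S) (S' \o T') Z Z' ->
  (forall z, T (S (Z z)) = T (S (X (Y z)))) ->
  (forall x, Z (T (S x)) = X (Y (T (S x)))) ->
  (forall x, S (X (T' (T (S x)))) = T' (T (S x))) /\
  (forall z, Y (T (S (S' (T' z)))) = S (S' (T' z))).
Proof.
move=> pTS range_eq corange_eq.
have pS' := penrose_dual pS; have pT' := penrose_dual pT.
have PP := penrose_range_proj pS.
have QQ := penrose_corange_proj pT.
have comm : forall w, S (X (Y (T w))) = Y (T (S (X w))).
  apply: (projection_commute PP QQ) => x /=.
  - by rewrite (penroseXK pS).
  - by rewrite (penroseK pT).
  - by rewrite -range_eq; have /= -> := penroseK pTS (X x).
have TPY := is_adjoint_comp (penrose_adjX pT) (is_adjoint_comp PP (penrose_adj pT)).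
have XQS := is_adjoint_comp (penrose_adj pS) (is_adjoint_comp QQ (penrose_adjX pS)).
have ZTS := penrose_corange_proj pTS.
split.
  apply: (gramian_invariant pS pT comm) => z; rewrite -range_eq.
  apply/esym/(is_adjoint_ext TPY (penrose_range_proj pTS)) => y.
  exact/esym/range_eq.
have inv' := gramian_invariant pT' pS'.
move=> z; rewrite (penroseXT pT); apply: inv' => {}z.
  by rewrite -(penroseTX pS) -!(penroseXT pT) -(penroseTX pS) comm.
rewrite -!(penroseXT pT) -corange_eq.
exact: (is_adjoint_ext XQS ZTS (fun x => esym (corange_eq x))).
Qed.

End ReverseOrder.
End PenroseAlgebra.

(** * Reverse order law *)

Lemma adjointable_comp (R : realType) (A : cstarAlgType R)
    (E F G : hilbertModType A) (S : E -> F) (T : F -> G) :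
  adjointable E F S -> adjointable F G T -> adjointable E G (T \o S).
Proof.
move=> hS hT; have [linS /rnorm_bounded[M M0 SM] _] := hS.
have [linT /rnorm_bounded[N N0 TN] _] := hT.
split.
- by move=> l x y /=; rewrite linS linT.
- exists (N * M)%:C%C => x; rewrite !rnormE -rmorphM/= lecR.
  by apply: (le_trans (TN _)); rewrite -mulrA ler_wpM2l.
- by exists (S^[*] \o T^[*]); apply: is_adjoint_comp; exact: adjointP.
Qed.

Theorem corollary2p3 (R : realType) (A : cstarAlgType R)
    (E F G : hilbertModType A) (S : E -> F) (T : F -> G)
    (hS : adjointable E F S) (hT : adjointable F G T)
    (clS : closed (range S)) (clT : closed (range T))
    (clTS : closed (range (T \o S))) :
  [<-> (T \o S)^† = S^† \o T^† ;
       T \o S \o (T \o S)^† = T \o S \o S^† \o T^† /\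
       (T \o S)^† \o T \o S = S^† \o T^† \o T \o S ;
       S \o S^† \o T^[*] \o T \o S = T^[*] \o T \o S /\
       T \o S \o S^[*] \o T^† \o T = T \o S \o S^[*] ;
       range (T^[*] \o T \o S) `<=` range S /\
       range (S \o S^[*] \o T^[*]) `<=` range T^[*] ].
Proof.
have pS := moore_penroseP hS clS; have pT := moore_penroseP hT clT.
have pTS := moore_penroseP (adjointable_comp hS hT) clTS.
have SS' := penrose_adj pS; have TT' := penrose_adj pT.
rewrite (adjointE (is_adjoint_comp SS' TT')) in pTS.
(* with Q = T^† T, the second equation of (iii) is the adjoint of
   Q S S^[*] T^[*] = S S^[*] T^[*], the first equation of (iii) for the pair
   (T^[*], S^[*]) *)
have swap : T \o S \o S^[*] \o T^† \o T = T \o S \o S^[*] <->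
    forall z, T^† (T (S (S^[*] (T^[*] z)))) = S (S^[*] (T^[*] z)).
  have QQ := penrose_corange_proj pT.
  have SSt := is_adjoint_comp (is_adjoint_sym SS') SS'.
  have lhs : is_adjoint (T \o S \o S^[*] \o T^† \o T)
      ((T^† \o T) \o ((S \o S^[*]) \o T^[*])).
    exact: is_adjoint_comp QQ (is_adjoint_comp SSt TT').
  have rhs : is_adjoint (T \o S \o S^[*]) ((S \o S^[*]) \o T^[*]).
    exact: is_adjoint_comp SSt TT'.
  split=> [e z|e].
    by apply: (is_adjoint_ext lhs rhs) => x; rewrite e.
  apply/funext; apply: (is_adjoint_ext (is_adjoint_sym lhs) (is_adjoint_sym rhs)).
  exact: e.
tfae.
- move=> e; split; first by rewrite e.
  by apply/funext => x /=; rewrite e.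
- move=> [range_eq corange_eq].
  have [z|x|inv inv'] := invariant_of_projections pS pT pTS.
  + exact: (congr1 (@^~ z) range_eq).
  + exact: (congr1 (@^~ x) corange_eq).
  by split; [apply/funext|apply/swap].
- move=> [inv /swap inv']; split=> _ [x _ <-].
  + by exists (S^† (T^[*] (T (S x)))) => //; exact: (congr1 (@^~ x) inv).
  + exists ((T^†)^[*] (S (S^[*] (T^[*] x)))) => //=.
    by rewrite -(penroseXT pT) inv'.
- move=> [sub sub']; apply/funext.
  apply: (penrose_unique pTS (reverse_order_invariant pS pT _ _)).
  + move=> x; have [|u _ <-] := sub (T^[*] (T (S x))); first by exists x.
    by rewrite (penroseK pS).
  + move=> z; have [|u _ <-] := sub' (S (S^[*] (T^[*] z))); first by exists z.
    by rewrite (penroseXT pT) (penroseK (penrose_dual pT)).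
Qed.
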